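(* Let $S\in\mathbb{R}^{n\times n}$ be a real skew-circulant matrix, where $n=2m$ or $n=2m+1$, and let $\tilde U\in\mathbb{R}^{n\times n}$ and $\Sigma\in\mathbb{R}^{n\times n}$ be the matrices defined in the context. Then $\tilde U$ is orthogonal and $\tilde U^{T}S\tilde U=\Sigma$; that is, $\Sigma$ is the real Schur form of $S$.
   Context: All indices start at $0$. A matrix $S=(s_{jk})_{j,k=0}^{n-1}$ is skew-circulant if $s_{jk}=s_{j-k}$ and $s_{-l}=-s_{n-l}$ for $1\le l\le n-1$. Let $\omega=\exp(2\pi i/n)$, let $F=(F_{jk})_{j,k=0}^{n-1}$ with $F_{jk}=\frac{1}{\sqrt n}\omega^{-jk}$ be the DFT matrix, let $D=\mathrm{diag}(1,e^{\pi i/n},\dots,e^{(n-1)\pi i/n})$, and let $\tilde F=DF^*$, a unitary matrix. Write $\tilde F=[\tilde{\boldsymbol f}_0,\dots,\tilde{\boldsymbol f}_{n-1}]$ by columns; these are eigenvectors of $S$, and $\tilde\lambda_k$ denotes the eigenvalue with $S\tilde{\boldsymbol f}_k=\tilde\lambda_k\tilde{\boldsymbol f}_k$. Write $\tilde\lambda_k=\tilde\alpha_k+i\tilde\beta_k$ with $\tilde\alpha_k,\tilde\beta_k\in\mathbb{R}$, and $\tilde{\boldsymbol f}_k=\tilde{\boldsymbol c}_k+i\tilde{\boldsymbol s}_k$ with $\tilde{\boldsymbol c}_k,\tilde{\boldsymbol s}_k\in\mathbb{R}^n$. (For real $S$, $\tilde\lambda_{n-1-k}=\overline{\tilde\lambda_k}$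 for $0\le k\le n-1$; in particular $\tilde\lambda_m$ is real if $n=2m+1$.) Definition of $\tilde U$ (by columns): - if $n=2m$: $\tilde U=[\sqrt2\,\tilde{\boldsymbol c}_0,\dots,\sqrt2\,\tilde{\boldsymbol c}_{m-1},\sqrt2\,\tilde{\boldsymbol s}_{m-1},\dots,\sqrt2\,\tilde{\boldsymbol s}_0]$; - if $n=2m+1$: $\tilde U=[\sqrt2\,\tilde{\boldsymbol c}_0,\dots,\sqrt2\,\tilde{\boldsymbol c}_{m-1},\tilde{\boldsymbol c}_m,\sqrt2\,\tilde{\boldsymbol s}_{m-1},\dots,\sqrt2\,\tilde{\boldsymbol s}_0]$. Definition of $\Sigma=(\Sigma_{jk})_{j,k=0}^{n-1}$: all entries are zero except that, for $0\le k\le m-1$, $\Sigma_{k,k}=\Sigma_{n-1-k,n-1-k}=\tilde\alpha_k$, $\Sigma_{k,n-1-k}=\tilde\beta_k$, $\Sigma_{n-1-k,k}=-\tilde\beta_k$, and, when $n=2m+1$, additionally $\Sigma_{mm}=\tilde\alpha_m$. A matrix of this shape can be brought by a permutation similarity to the usual block-diagonal real Schur canonical form with diagonal blocks of size $1$ and $2$; for this reason $\Sigma$, being orthogonally similar to $S$, is itself called the real Schur form of $S$. *)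

(* Defs.v *)
From HB Require Import structures.
From mathcomp Require Import all_boot all_order all_algebra.
From mathcomp Require Import all_fingroup.
From mathcomp Require Import boolp classical_sets reals trigo.
From mathcomp Require Import complex.

Set Implicit Arguments.
Unset Strict Implicit.
Unset Printing Implicit Defensive.

Import Order.TTheory GRing.Theory Num.Theory.
Local Open Scope ring_scope.
Local Open Scope complex_scope.

Definition skew_circulant (R : realType) (n : nat) (S : 'M[R]_n) : Prop :=
  exists s : int -> R,
    (forall l : nat, (1 <= l <= n.-1)%N -> s (- l%:Z) = - s (n%:Z - l%:Z)) /\
    (forall j k : 'I_n, S j k = s ((j : nat)%:Z - (k : nat)%:Z)).

Definition orthogonal_mx (R : realType) (n : nat) (Q : 'M[R]_n) : Prop :=
  Q^T *m Q = 1%:M.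

(* exp(i t) for real t, by Euler's formula *)
Definition expi (R : realType) (t : R) : R[i] := cos t +i* sin t.

Definition adjoint_mx (R : realType) (n : nat) (A : 'M[R[i]]_n) : 'M[R[i]]_n :=
  map_mx (@conjc R) A^T.

Definition omega (R : realType) (n : nat) : R[i] := expi (2 * pi / n%:R : R).

Definition dft_mx (R : realType) (n : nat) : 'M[R[i]]_n :=
  \matrix_(j < n, k < n)
    (((Num.sqrt (n%:R : R))^-1)%:C * omega R n ^- (j * k)%N).

Definition twist_mx (R : realType) (n : nat) : 'M[R[i]]_n :=
  diag_mx (\row_(j < n) expi (j%:R * pi / n%:R : R)).

Definition Ftilde (R : realType) (n : nat) : 'M[R[i]]_n :=
  twist_mx R n *m adjoint_mx (dft_mx R n).

Definition ftilde (R : realType) (n : nat) (k : 'I_n) : 'cV[R[i]]_n :=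
  col k (Ftilde R n).

Definition ctilde (R : realType) (n : nat) (k : 'I_n) : 'cV[R]_n :=
  map_mx (@complex.Re R) (ftilde R k).

Definition stilde (R : realType) (n : nat) (k : 'I_n) : 'cV[R]_n :=
  map_mx (@complex.Im R) (ftilde R k).

(* The scalar l with S f_k = l f_k: unique since f_k is nonzero; the default 0
   is returned only if f_k is not an eigenvector of S. *)
Definition lambda_tilde (R : realType) (n : nat) (S : 'M[R]_n) (k : 'I_n) :
    R[i] :=
  xget 0 [set l : R[i] |
    map_mx (real_complex R) S *m ftilde R k = l *: ftilde R k]%classic.

Definition alpha_tilde (R : realType) (n : nat) (S : 'M[R]_n) (k : 'I_n) : R :=
  complex.Re (lambda_tilde S k).

Definition beta_tilde (R : realType) (n : nat) (S : 'M[R]_n) (k : 'I_n) : R :=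
  complex.Im (lambda_tilde S k).

(* Here and in Sigma_mx, n is meant to be 2m or 2m+1, and rev_ord k is the index
   n-1-k. *)
Definition Utilde (R : realType) (n m : nat) : 'M[R]_n :=
  \matrix_(i < n, j < n)
    if (j < m)%N then Num.sqrt 2 * ctilde R j i 0
    else if (n == (2 * m).+1) && (j == m :> nat) then ctilde R j i 0
    else Num.sqrt 2 * stilde R (rev_ord j) i 0.

Definition Sigma_mx (R : realType) (n m : nat) (S : 'M[R]_n) : 'M[R]_n :=
  \matrix_(j < n, k < n)
    if k == j then
      if (j < m)%N then alpha_tilde S j
      else if (n == (2 * m).+1) && (j == m :> nat) then alpha_tilde S j
      else alpha_tilde S (rev_ord j)
    else if k == rev_ord j then
      if (j < m)%N then beta_tilde S j else - beta_tilde S k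
    else 0.

(* The block-diagonal real Schur canonical form of a real normal matrix.
   b i is the label of the diagonal block containing row i; as b is
   nondecreasing, blocks consist of consecutive indices.  Blocks have size 1 or
   2, and those of size 2 are [p q; -q p] with q != 0, that is, they carry a
   pair of non-real conjugate eigenvalues p +- iq. *)
Definition block_diag_schur (R : realType) (n : nat) (T : 'M[R]_n) : Prop :=
  exists b : 'I_n -> nat,
    [/\ forall i j : 'I_n, (i <= j)%N -> (b i <= b j)%N,
        forall l : nat, (#|[set i : 'I_n | b i == l]| <= 2)%N,
        forall i j : 'I_n, b i != b j -> T i j = 0 &
        forall i j : 'I_n, i != j -> b i = b j ->
          [/\ T j j = T i i, T j i = - T i j & T i j != 0]].

(* T is "the real Schur form of S" up to the order of the indices: T is
   orthogonally similar to S, and permutation similar to a matrix in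
   block-diagonal real Schur canonical form. *)
Definition real_schur_form (R : realType) (n : nat) (S T : 'M[R]_n) : Prop :=
  (exists2 Q : 'M[R]_n, orthogonal_mx Q & Q^T *m S *m Q = T) /\
  (exists s : 'S_n, block_diag_schur ((perm_mx s)^T *m T *m perm_mx s)).

(* Main.v *)
(* Column k of Ftilde has entries n^(-1/2) exp(i j theta_k) with
   theta_k = (2k+1) pi / n.  Since exp(i n theta_k) = -1, the sequence
   d |-> s_d exp(- i d theta_k) attached to a skew-circulant S is n-periodic,
   which makes each column an eigenvector.  As theta_k - theta_l and
   theta_k + theta_l are integer multiples of 2 pi / n, the product-to-sum
   formulas reduce the inner products of the real and imaginary parts of the
   columns to sums of n-th roots of unity.  Taking real and imaginary parts of
   the eigenvector equation gives S U = U Sigma.  Interleaving the indices k and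
   n-1-k brings Sigma to block-diagonal form. *)

Require Import Defs.
From mathcomp Require Import all_boot all_order all_algebra.
From mathcomp Require Import all_fingroup.
From mathcomp Require Import reals boolp classical_sets trigo complex.
From mathcomp Require Import zify ring lra.

Set Implicit Arguments.
Unset Strict Implicit.
Unset Printing Implicit Defensive.

Import Order.TTheory GRing.Theory Num.Theory.
Local Open Scope ring_scope.

(** * Complex exponentials and sums of roots of unity *)

Lemma expiD (R : realType) (x y : R) : expi (x + y) = expi x * expi y.
Proof. by rewrite /expi cosD sinD; simpc; rewrite [sin x * _ + _]addrC. Qed.

Lemma expi0 (R : realType) : expi (0 : R) = 1.
Proof. by rewrite /expi cos0 sin0. Qed.

Lemma expiV (R : realType) (x : R) : (expi x)^-1 = expi (- x).
Proof. by apply: mulr1_eq; rewrite -expiD subrr expi0. Qed.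

Lemma expiX (R : realType) (x : R) (k : nat) : expi x ^+ k = expi (k%:R * x).
Proof.
elim: k => [|k IHk]; first by rewrite expr0 mul0r expi0.
by rewrite exprS IHk -expiD -natr1; congr expi; ring.
Qed.

Lemma expiDpi (R : realType) (x : R) : expi (x + pi) = - expi x.
Proof. by rewrite /expi cosDpi sinDpi; simpc. Qed.

Lemma expi_pi_nat (R : realType) (k : nat) : expi (k%:R * pi : R) = (-1) ^+ k.
Proof. by rewrite -expiX -[pi]add0r expiDpi expi0. Qed.

Lemma expi_2pi_int (R : realType) (d : int) : expi (d%:~R * (2 * pi) : R) = 1.
Proof.
have nat_case (k : nat) : expi (k%:R * (2 * pi) : R) = 1.
  by rewrite mulrA -natrM expi_pi_nat mulnC exprM sqrrN expr1n expr1n.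
case: d => k; first exact: nat_case.
by rewrite NegzE mulrNz mulNr -expiV nat_case invr1.
Qed.

(** If [cos t = 1], the half-angle formula gives [sin (|t| / 2) = 0], but the sine is positive on
    the open interval from 0 to [pi]. *)
Lemma expi_neq1 (R : realType) (t : R) : 0 < `|t| < 2 * pi -> expi t != 1.
Proof.
move=> t_bd; apply/eqP => -[cos_t _].
have sin_half : sin (`|t| / 2) = 0.
  have := cos_mulr2n (`|t| / 2); rewrite cos2sin2.
  have -> : `|t| / 2 *+ 2 = `|t| by field.
  have -> : cos `|t| = 1 by case: (ger0P t); rewrite ?cosN.
  by move=> ?; apply/eqP; rewrite -sqrf_eq0; apply/eqP; lra.
have : 0 < sin (`|t| / 2) by apply: sin_gt0_pi; lra.
by rewrite sin_half ltxx.
Qed.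

(** A geometric sum in an n-th root of unity x: all terms are 1 when n divides d; otherwise x
    differs from 1 and the sum is killed by the factorization of [x ^+ n - 1]. *)
Lemma sum_expi_int (R : realType) (n : nat) (d : int) : (0 < n)%N ->
  \sum_(i < n) expi (i%:R * (d%:~R * (2 * pi) / n%:R) : R) =
  (n%:R * (n %| d)%Z%:R)%R.
Proof.
move=> n_gt0; have nR_gt0 : 0 < n%:R :> R by rewrite ltr0n.
set x : R := d%:~R * _ / _.
(* Reducing d modulo n brings the angle into the range from 0 to [2 * pi] that [expi_neq1] needs. *)
have expi_x : expi x = expi ((d %% n)%Z%:~R * (2 * pi) / n%:R).
  rewrite /x {1}(divz_eq d n) rmorphD rmorphM /= -pmulrn.
  rewrite -[RHS]mul1r -(expi_2pi_int R (d %/ n)%Z) -expiD; congr expi.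
  by field; rewrite gt_eqF.
have expi_xn : expi x ^+ n = 1.
  by rewrite expiX mulrC divfK ?gt_eqF // expi_2pi_int.
under eq_bigr do rewrite -expiX.
have [/dvdz_mod0P d_mod | nd_mod] := boolP (n %| d)%Z.
  rewrite mulr1 -[in RHS](card_ord n) -sumr_const.
  by apply: eq_bigr => i _; rewrite expi_x d_mod !mul0r expi0 expr1n.
have /negPf x_neq1 : expi x != 1.
  rewrite expi_x; apply: expi_neq1.
  have r_ge0 : (0 <= d %% n)%Z by apply: modz_ge0; lia.
  have r_lt : ((d %% n)%Z < n)%R by apply: ltz_pmod; lia.
  have r_gt0 : (0 < d %% n)%Z.
    rewrite lt_neqAle eq_sym r_ge0 andbT.
    by apply: contra nd_mod => /eqP/dvdz_mod0P.
  have twopi_gt0 : 0 < 2 * pi :> R by rewrite mulr_gt0 ?pi_gt0.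
  have rR_gt0 : 0 < (d %% n)%Z%:~R :> R by rewrite ltr0z.
  have t_gt0 : 0 < (d %% n)%Z%:~R * (2 * pi) / n%:R :> R.
    exact: divr_gt0 (mulr_gt0 rR_gt0 twopi_gt0) nR_gt0.
  rewrite gtr0_norm // t_gt0 /=.
  by rewrite ltr_pdivrMr // mulrC ltr_pM2l // pmulrn ltr_int.
have := subrX1 (expi x) n; rewrite expi_xn subrr => /esym/eqP.
by rewrite mulf_eq0 subr_eq0 x_neq1 mulr0 => /eqP.
Qed.

(** * Trigonometric form of the columns of [Ftilde] *)

Definition skew_angle (R : realType) (n k : nat) : R :=
  k.*2.+1%:R * pi / n%:R.

Lemma conj_scaled_expi (R : realType) (a x : R) :
  conjc (a%:C * expi x)%C = (a%:C * expi (- x))%C.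
Proof. by rewrite /expi cosN sinN; simpc. Qed.

(** Per row, the twist turns by [pi / n] and the conjugated DFT column by [2 k pi / n]; together
    they turn by [skew_angle R n k]. *)
Lemma ftildeE (R : realType) (n : nat) (k i : 'I_n) :
  ftilde R k i 0 =
  (((Num.sqrt n%:R)^-1)%:C * expi (i%:R * skew_angle R n k))%C.
Proof.
rewrite mxE /Ftilde mul_diag_mx !mxE /omega expiX expiV conj_scaled_expi opprK.
rewrite mulrCA -expiD /skew_angle -muln2 -natr1 !natrM; congr (_ * expi _).
by ring.
Qed.

Lemma ctildeE (R : realType) (n : nat) (k i : 'I_n) :
  ctilde R k i 0 = (Num.sqrt n%:R)^-1 * cos (i%:R * skew_angle R n k).
Proof. by rewrite mxE ftildeE /expi /=; simpc. Qed.

Lemma stildeE (R : realType) (n : nat) (k i : 'I_n) :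
  stilde R k i 0 = (Num.sqrt n%:R)^-1 * sin (i%:R * skew_angle R n k).
Proof. by rewrite mxE ftildeE /expi /=; simpc. Qed.

Lemma skew_angleB (R : realType) (n k l : nat) :
  skew_angle R n k - skew_angle R n l =
  (k%:Z - l%:Z)%:~R * (2 * pi) / n%:R.
Proof.
by rewrite /skew_angle -!natr1 -!addnn !natrD rmorphB /= !pmulrn; ring.
Qed.

Lemma skew_angleD (R : realType) (n k l : nat) :
  skew_angle R n k + skew_angle R n l =
  (k + l).+1%:Z%:~R * (2 * pi) / n%:R.
Proof.
by rewrite /skew_angle -pmulrn -!natr1 -!addnn !natrD; ring.
Qed.

Lemma sum_expi_angleB (R : realType) (n : nat) (k l : 'I_n) :
  \sum_(i < n) expi (i%:R * (skew_angle R n k - skew_angle R n l)) =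
  (n%:R * (k == l)%:R)%R.
Proof.
have ? := ltn_ord k; have ? := ltn_ord l.
rewrite skew_angleB sum_expi_int; last lia.
by rewrite -eqz_mod_dvd !modz_nat !modn_small.
Qed.

(** Since k + l + 1 lies between 1 and 2n - 1, its only possible multiple of n is n itself, that is
    l = n - 1 - k. *)
Lemma sum_expi_angleD (R : realType) (n : nat) (k l : 'I_n) :
  \sum_(i < n) expi (i%:R * (skew_angle R n k + skew_angle R n l)) =
  (n%:R * (l == rev_ord k)%:R)%R.
Proof.
have ? := ltn_ord k; have ? := ltn_ord l.
rewrite skew_angleD sum_expi_int; last lia.
congr (_ * (nat_of_bool _)%:R).
apply/dvdnP/eqP => [[q q_def] | ->]; last by exists 1%N; rewrite /=; lia.
by apply: val_inj => /=; case: q q_def => [|[|q]] q_def; nia.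
Qed.

Lemma sum_complexE (R : realType) (I : Type) (r : seq I) (f g : I -> R) :
  \sum_(i <- r) (f i +i* g i)%C =
    ((\sum_(i <- r) f i) +i* (\sum_(i <- r) g i))%C.
Proof.
elim: r => [|i r IHr]; first by rewrite !big_nil.
by rewrite !big_cons IHr; simpc.
Qed.

(** * Inner products of the real and imaginary parts of the columns *)

Section Gram.
Variables (R : realType) (n : nat).
Implicit Types k l : 'I_n.
Let th := skew_angle R n.

Lemma sum_cosB k l :
  \sum_(i < n) cos (i%:R * (th k - th l)) = n%:R * (k == l)%:R.
Proof.
have := sum_expi_angleB R k l.
rewrite sum_complexE -natrM -(rmorph_nat (real_complex R)) natrM => -[].
by [].
Qed.

Lemma sum_sinB k l : \sum_(i < n) sin (i%:R * (th k - th l)) = 0.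
Proof.
have := sum_expi_angleB R k l.
by rewrite sum_complexE -natrM -(rmorph_nat (real_complex R)) => -[].
Qed.

Lemma sum_cosD k l :
  \sum_(i < n) cos (i%:R * (th k + th l)) = n%:R * (l == rev_ord k)%:R.
Proof.
have := sum_expi_angleD R k l.
by rewrite sum_complexE -natrM -(rmorph_nat (real_complex R)) natrM => -[].
Qed.

Lemma sum_sinD k l : \sum_(i < n) sin (i%:R * (th k + th l)) = 0.
Proof.
have := sum_expi_angleD R k l.
by rewrite sum_complexE -natrM -(rmorph_nat (real_complex R)) => -[].
Qed.

(** The two normalizing factors multiply to 1/n and cancel the n of the root-of-unity sums; the
    index [k] witnesses that n is nonzero. *)
Let scaled_sum (k : 'I_n) (f g : 'I_n -> R) (a : R) :
  \sum_(i < n) g i = n%:R * a ->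
  (forall i, f i = (Num.sqrt n%:R)^-1 ^+ 2 * g i) -> \sum_(i < n) f i = a.
Proof.
move=> sum_g fE; under eq_bigr do rewrite fE.
rewrite -mulr_sumr sum_g exprVn sqr_sqrtr ?ler0n // mulKf // pnatr_eq0.
by have := ltn_ord k; lia.
Qed.

(** Both indicators equal 1 when k = l is the middle index, so that column has norm 1 already; this
    is why [Utilde] does not scale it by the square root of 2. *)
Lemma gram_cc k l : \sum_(i < n) ctilde R k i 0 * ctilde R l i 0 =
  ((k == l)%:R + (l == rev_ord k)%:R) / 2.
Proof.
apply: (scaled_sum k (g := fun i : 'I_n =>
  (cos (i%:R * (th k - th l)) + cos (i%:R * (th k + th l))) / 2)) => [|i].
  by rewrite -mulr_suml big_split /= sum_cosB sum_cosD; ring.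
by rewrite !ctildeE mulrBr mulrDr cosB cosD /th; move: (Num.sqrt _)^-1 => c;
  field.
Qed.

Lemma gram_ss k l : \sum_(i < n) stilde R k i 0 * stilde R l i 0 =
  ((k == l)%:R - (l == rev_ord k)%:R) / 2.
Proof.
apply: (scaled_sum k (g := fun i : 'I_n =>
  (cos (i%:R * (th k - th l)) - cos (i%:R * (th k + th l))) / 2)) => [|i].
  by rewrite -mulr_suml sumrB /= sum_cosB sum_cosD; ring.
by rewrite !stildeE mulrBr mulrDr cosB cosD /th; move: (Num.sqrt _)^-1 => c;
  field.
Qed.

Lemma gram_sc k l : \sum_(i < n) stilde R k i 0 * ctilde R l i 0 = 0.
Proof.
apply: (scaled_sum k (g := fun i : 'I_n =>
  (sin (i%:R * (th k - th l)) + sin (i%:R * (th k + th l))) / 2)) => [|i].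
  by rewrite -mulr_suml big_split /= sum_sinB sum_sinD; ring.
by rewrite stildeE ctildeE mulrBr mulrDr sinB sinD /th; move: (Num.sqrt _)^-1
  => c; field.
Qed.

(** At the middle index the two indicators of [gram_ss] cancel, so the column has zero squared
    norm. *)
Lemma stilde_mid k : rev_ord k = k -> stilde R k = 0.
Proof.
move=> rev_k; apply/colP => i; rewrite [RHS]mxE; apply/eqP.
have : \sum_(i < n) stilde R k i 0 ^+ 2 == 0.
  by under eq_bigr do rewrite expr2; rewrite gram_ss rev_k eqxx subrr mul0r.
rewrite psumr_eq0 => [/allP/(_ i)|j _]; last exact: sqr_ge0.
by rewrite mem_index_enum /= sqrf_eq0; apply.
Qed.

End Gram.

(** * The eigenvector equation and its real and imaginary parts *)

Lemma skew_circulant_eigen (R : realType) (n : nat) (S : 'M[R]_n) (k : 'I_n) :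
  skew_circulant S ->
  exists l : R[i], map_mx (real_complex R) S *m ftilde R k = l *: ftilde R k.
Proof.
move=> [s [s_neg SE]]; set t := skew_angle R n k.
have n_gt0 : (0 < n)%N by have := ltn_ord k; lia.
(* Row j of the product is [expi (j%:R * t)] times the sum over l of [g (j - l)], up to the common
   normalization; [g_shift] makes that sum independent of j. *)
pose g (d : int) : R[i] := ((s d)%:C * expi (- (d%:~R * t)))%C.
have g_neg (l : nat) : (1 <= l <= n.-1)%N -> g (- l%:Z) = g (n%:Z - l%:Z).
  move=> l_bd; rewrite /g s_neg // rmorphN /= mulNr -mulrN; congr (_ * _).
  (* Here [n%:R * t] is an odd multiple of [pi], so shifting the argument of [g] by n yields a sign
     that cancels the one in [s_neg]. *)
  have nt_pi : n%:R * t = k.*2%:R * pi + pi.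
    by rewrite /t /skew_angle mulrC divfK ?pnatr_eq0 -?lt0n // -natr1 mulrDl
      mul1r.
  have -> : - ((n%:Z - l%:Z)%:~R * t) = - (- l%:Z)%:~R * t - n%:R * t.
    by rewrite rmorphB rmorphN /= pmulrn; ring.
  rewrite expiD -[expi (- (n%:R * t))]expiV nt_pi expiDpi expi_pi_nat.
  by rewrite -mul2n exprM sqrrN !expr1n invrN1 mulrN1 mulNr.
have g_shift (j : nat) : (j < n)%N ->
    \sum_(l < n) g (j%:Z - l%:Z) = \sum_(l < n) g (- l%:Z).
  elim: j => [|j IHj] j_lt; first by under eq_bigr do rewrite sub0r.
  rewrite -IHj; last exact: ltnW.
  have [p n_def] : exists p, n = p.+1 by exists n.-1; lia.
  (* Passing from j to j + 1 gains the first term [g (j + 1)] and loses the last, [g (j - (n - 1))];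
     the two agree by [g_neg]. *)
  rewrite n_def big_ord_recl big_ord_recr /= addrC; congr (_ + _).
    have -> : j%:Z - p%:Z = - (p - j)%N%:Z by lia.
    by rewrite g_neg; [congr g; lia | lia].
  by apply: eq_bigr => l _; congr g; rewrite /= /bump; lia.
exists (\sum_(l < n) g (- l%:Z)); apply/colP => j; rewrite [LHS]mxE [RHS]mxE.
rewrite -(g_shift j) // mulr_suml; apply: eq_bigr => l _.
rewrite mxE SE !ftildeE /g -/t.
have -> : l%:R * t = - ((j%:Z - l%:Z)%:~R * t) + j%:R * t.
  by rewrite rmorphB /= -!pmulrn; ring.
by rewrite expiD; ring.
Qed.

Section RealEigen.
Variables (R : realType) (n : nat) (S : 'M[R]_n).
Hypothesis S_skew : skew_circulant S.
Let a := alpha_tilde S.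
Let b := beta_tilde S.

(** Existence of an eigenvalue ensures that [xget] returns one instead of falling back on its
    default. *)
Lemma lambda_tildeP (k : 'I_n) :
  map_mx (real_complex R) S *m ftilde R k = lambda_tilde S k *: ftilde R k.
Proof. exact: (xgetPex 0 (skew_circulant_eigen k S_skew)). Qed.

Lemma mul_ctilde_stilde (k i : 'I_n) :
  \sum_(l < n) S i l * ctilde R k l 0 =
    a k * ctilde R k i 0 - b k * stilde R k i 0 /\
  \sum_(l < n) S i l * stilde R k l 0 =
    b k * ctilde R k i 0 + a k * stilde R k i 0.
Proof.
have := congr1 (fun M : 'cV_n => M i 0) (lambda_tildeP k).
rewrite [LHS]mxE [RHS]mxE.
have fE l : ftilde R k l 0 = (ctilde R k l 0 +i* stilde R k l 0)%C.
  by rewrite [ctilde _ _ _ _]mxE [stilde _ _ _ _]mxE; case: (ftilde R k l 0).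
have -> : lambda_tilde S k = (a k +i* b k)%C.
  by rewrite /a /b /alpha_tilde /beta_tilde; case: lambda_tilde.
have SfE l : map_mx (real_complex R) S i l * ftilde R k l 0 =
    (S i l * ctilde R k l 0 +i* (S i l * stilde R k l 0))%C.
  by rewrite mxE fE; simpc.
rewrite (eq_bigr _ (fun l _ => SfE l)) sum_complexE fE; simpc.
by move=> [-> ->]; split; rewrite // addrC.
Qed.
End RealEigen.

(** * Orthogonality of [Utilde] and the similarity between [S] and [Sigma_mx] *)

Section Schur.
Variables (R : realType) (n m : nat).
Hypothesis n_eq : n = (2 * m)%N \/ n = (2 * m).+1.
Let U := Utilde R n m.

Lemma rev_ord_lt (k : 'I_n) : (k < m)%N ->
  [/\ (rev_ord k < m)%N = false,
      ((n == (2 * m).+1) && (rev_ord k == m :> nat)) = false &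
      (rev_ord k == k) = false].
Proof.
move=> k_lt; have ? := ltn_ord k.
by split; rewrite -?val_eqE /=; case: n_eq; lia.
Qed.

(** These cases follow the layout of [Utilde]: cosine columns, mirrored sine columns, and the middle
    column for odd n. *)
Lemma ord_cases (k : 'I_n) :
  [\/ (k < m)%N, exists2 l : 'I_n, (l < m)%N & k = rev_ord l |
     [/\ rev_ord k = k, (k < m)%N = false &
         (n == (2 * m).+1) && (k == m :> nat)]].
Proof.
have ? := ltn_ord k.
have [k_lt | m_lt | k_m] := ltngtP k m; first by constructor 1.
  constructor 2; exists (rev_ord k); last by rewrite rev_ordK.
  by rewrite /=; case: n_eq; lia.
case: n_eq => n_def.
  constructor 2; exists (rev_ord k); last by rewrite rev_ordK.
  by rewrite /=; lia.
by constructor 3; split; rewrite ?n_def ?eqxx //; apply: val_inj => /=; lia.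
Qed.

Lemma Utilde_lt (i k : 'I_n) : (k < m)%N ->
  U i k = Num.sqrt 2 * ctilde R k i 0.
Proof. by move=> k_lt; rewrite mxE k_lt. Qed.

Lemma Utilde_rev (i k : 'I_n) : (k < m)%N ->
  U i (rev_ord k) = Num.sqrt 2 * stilde R k i 0.
Proof. by move=> /rev_ord_lt[rev1 rev2 _]; rewrite mxE rev1 rev2 rev_ordK. Qed.

Lemma Utilde_mid (i k : 'I_n) :
  (k < m)%N = false -> (n == (2 * m).+1) && (k == m :> nat) ->
  U i k = ctilde R k i 0.
Proof. by move=> k1 k2; rewrite mxE k1 k2. Qed.

Lemma Utilde_orthogonal : orthogonal_mx U.
Proof.
have sqrt2 : Num.sqrt 2 * Num.sqrt 2 = 2 :> R by rewrite -expr2 sqr_sqrtr.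
have sum_scale (x y : R) (f g : 'I_n -> R) :
    \sum_(i < n) x * f i * (y * g i) = x * y * \sum_(i < n) f i * g i.
  by rewrite mulr_sumr; apply: eq_bigr => i _; ring.
have gram_cs (k l : 'I_n) : \sum_(i < n) ctilde R k i 0 * stilde R l i 0 = 0.
  by under eq_bigr do rewrite mulrC; exact: gram_sc.
apply/matrixP => k l; rewrite mxE [RHS]mxE; under eq_bigr do rewrite mxE.
have ? := ltn_ord k; have ? := ltn_ord l.
case: (ord_cases k) => [k_lt | [k' k_lt ->] | [k_rev k_ge k_mid]];
  case: (ord_cases l) => [l_lt | [l' l_lt ->] | [l_rev l_ge l_mid]].
- have k_nrev : (l == rev_ord k) = false by rewrite -val_eqE /=; lia.
  under eq_bigr do rewrite (Utilde_lt _ k_lt) (Utilde_lt _ l_lt).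
  by rewrite sum_scale sqrt2 gram_cc k_nrev addr0 mulrC divfK ?pnatr_eq0.
- have k_neq : (k == rev_ord l') = false by rewrite -val_eqE /=; lia.
  under eq_bigr do rewrite (Utilde_lt _ k_lt) (Utilde_rev _ l_lt).
  by rewrite sum_scale gram_cs k_neq mulr0.
- have k_neq : (k == l) = false by rewrite -val_eqE /=; lia.
  have k_nrev : (l == rev_ord k) = false by rewrite -val_eqE /=; lia.
  (* The middle column gets an explicit factor 1 to match the shape of [sum_scale]. *)
  under eq_bigr do rewrite (Utilde_lt _ k_lt) (Utilde_mid _ l_ge l_mid)
    -[ctilde R l _ _]mul1r.
  by rewrite sum_scale gram_cc k_neq k_nrev addr0 mul0r mulr0.
- have k_neq : (rev_ord k' == l) = false by rewrite -val_eqE /=; lia.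
  under eq_bigr do rewrite (Utilde_rev _ k_lt) (Utilde_lt _ l_lt).
  by rewrite sum_scale gram_sc k_neq mulr0.
- have k_nrev : (l' == rev_ord k') = false by rewrite -val_eqE /=; lia.
  under eq_bigr do rewrite (Utilde_rev _ k_lt) (Utilde_rev _ l_lt).
  rewrite sum_scale sqrt2 gram_ss k_nrev (inj_eq rev_ord_inj).
  by rewrite subr0 mulrC divfK ?pnatr_eq0.
- have k_neq : (rev_ord k' == l) = false by rewrite -val_eqE /=; lia.
  under eq_bigr do rewrite (Utilde_rev _ k_lt) (Utilde_mid _ l_ge l_mid)
    -[ctilde R l _ _]mul1r.
  by rewrite sum_scale gram_sc k_neq mulr0.
- have k_neq : (k == l) = false by rewrite -val_eqE /=; lia.
  have k_nrev : (l == rev_ord k) = false by rewrite -val_eqE /=; lia.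
  under eq_bigr do rewrite (Utilde_mid _ k_ge k_mid) (Utilde_lt _ l_lt)
    -[ctilde R k _ _]mul1r.
  by rewrite sum_scale gram_cc k_neq k_nrev addr0 mul0r mulr0.
- have k_neq : (k == rev_ord l') = false by rewrite -val_eqE /=; lia.
  under eq_bigr do rewrite (Utilde_mid _ k_ge k_mid) (Utilde_rev _ l_lt)
    -[ctilde R k _ _]mul1r.
  by rewrite sum_scale gram_cs k_neq mulr0.
- have -> : l = k by apply: val_inj => /=; lia.
  under eq_bigr do rewrite !(Utilde_mid _ k_ge k_mid).
  by rewrite gram_cc k_rev eqxx mulrDl -splitr.
Qed.

Lemma Sigma_pair (S : 'M[R]_n) (k : 'I_n) : (k < m)%N ->
  [/\ Sigma_mx m S k k = alpha_tilde S k,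
      Sigma_mx m S (rev_ord k) (rev_ord k) = alpha_tilde S k,
      Sigma_mx m S k (rev_ord k) = beta_tilde S k &
      Sigma_mx m S (rev_ord k) k = - beta_tilde S k].
Proof.
move=> k_lt; have [rev1 rev2 rev3] := rev_ord_lt k_lt.
by split; rewrite mxE ?eqxx ?rev_ordK ?k_lt ?rev1 ?rev2 ?rev3 // eq_sym ?rev3
  eqxx.
Qed.

(** Column k of [Sigma_mx] is supported on rows k and n - 1 - k, so column k of the product combines
    a cosine column with its sine partner, as in [mul_ctilde_stilde]. *)
Lemma mul_Utilde_Sigma (S : 'M[R]_n) (S_skew : skew_circulant S) :
  S *m U = U *m Sigma_mx m S.
Proof.
pose Sg := Sigma_mx m S.
have sum_pair (i k : 'I_n) : rev_ord k != k ->
    \sum_(j < n) U i j * Sg j k = U i k * Sg k k + U i (rev_ord k) * Sg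
      (rev_ord k) k.
  move=> k_nrev; rewrite (bigD1 k) //= (bigD1 (rev_ord k)) //= big1 ?addr0 //.
  move=> j /andP[/negPf j_k /negPf j_rev].
  by rewrite [Sg _ _]mxE [k == j]eq_sym j_k -(can_eq (@rev_ordK n)) rev_ordK
    eq_sym j_rev mulr0.
have S_scale (i : 'I_n) (x : R) (f : 'I_n -> R) :
    \sum_(j < n) S i j * (x * f j) = x * \sum_(j < n) S i j * f j.
  by rewrite mulr_sumr; apply: eq_bigr => j _; rewrite mulrCA.
apply/matrixP => i k; rewrite [LHS]mxE [RHS]mxE.
case: (ord_cases k) => [k_lt | [l l_lt ->] | [k_rev k_ge k_mid]].
- have [rev1 rev2 rev3] := rev_ord_lt k_lt.
  have [S1 S2 S3 S4] := Sigma_pair S k_lt.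
  rewrite sum_pair ?rev3 // Utilde_lt // Utilde_rev // S1 S4.
  under eq_bigr do rewrite Utilde_lt //.
  by rewrite S_scale (mul_ctilde_stilde S_skew k i).1; ring.
- have [rev1 rev2 rev3] := rev_ord_lt l_lt.
  have [S1 S2 S3 S4] := Sigma_pair S l_lt.
  rewrite sum_pair rev_ordK 1?eq_sym ?rev3 // (Utilde_lt _ l_lt)
    (Utilde_rev _ l_lt) S2 S3.
  under eq_bigr do rewrite Utilde_rev //.
  by rewrite S_scale (mul_ctilde_stilde S_skew l i).2; ring.
(* For the middle column, rows k and n - 1 - k coincide, and the term in [beta_tilde] drops out
   because [stilde R k] vanishes. *)
- rewrite [RHS](bigD1 k) //= [X in _ = _ + X]big1 ?addr0 => [|j j_k]; last
  first.
    rewrite [Sigma_mx m S j k]mxE [k == j]eq_sym (negPf j_k).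
    by rewrite -(can_eq (@rev_ordK n)) rev_ordK k_rev eq_sym (negPf j_k) mulr0.
  under eq_bigr do rewrite Utilde_mid //.
  rewrite (mul_ctilde_stilde S_skew k i).1 (stilde_mid R k_rev) Utilde_mid //.
  by rewrite [(0 : 'cV_n) _ _]mxE mulr0 subr0 [Sigma_mx m S k k]mxE eqxx k_ge
    k_mid mulrC.
Qed.

Lemma Utilde_Sigma (S : 'M[R]_n) : skew_circulant S ->
  U^T *m S *m U = Sigma_mx m S.
Proof.
move=> S_skew; rewrite -mulmxA mul_Utilde_Sigma // mulmxA.
by rewrite Utilde_orthogonal mul1mx.
Qed.

(* The order 0, n-1, 1, n-2, ..., ending with m when n = 2m+1. *)
Definition fold_index (p : nat) : nat :=
  if (2 * m <= p)%N then m else if odd p then (n.-1 - p./2)%N else p./2.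

Lemma fold_index_lt (p : 'I_n) : (fold_index p < n)%N.
Proof.
by rewrite /fold_index; have := ltn_ord p; case: n_eq; do ?case: ifP; lia.
Qed.

Definition fold_ord (p : 'I_n) : 'I_n := Ordinal (fold_index_lt p).

Lemma fold_ord_inj : injective fold_ord.
Proof.
move=> p q /(congr1 val) /=; rewrite /fold_index => pq; apply: val_inj => /=.
have ? := ltn_ord p; have ? := ltn_ord q; move: pq.
by case: n_eq; do ?case: ifP; lia.
Qed.

(** Positions 2i and 2i + 1 receive the indices i and n - 1 - i. *)
Lemma fold_ord_pair (p q : 'I_n) : odd q -> q = p.+1 :> nat ->
  (fold_ord p < m)%N /\ fold_ord q = rev_ord (fold_ord p).
Proof.
move=> q_odd q_eq; have ? := ltn_ord q.
split; last apply: val_inj; rewrite /= /fold_index;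
  by case: n_eq; do ?case: ifP; lia.
Qed.

Lemma fold_ord_rev (p q : 'I_n) : (p < q)%N ->
  fold_ord q = rev_ord (fold_ord p) -> odd q /\ q = p.+1 :> nat.
Proof.
move=> p_lt /(congr1 val); have ? := ltn_ord q; rewrite /= /fold_index.
by case: n_eq; do ?case: ifP; lia.
Qed.

(** * Block-diagonal form of the reordered [Sigma_mx] *)

Section Blocks.
Variable S : 'M[R]_n.

Let T (p q : 'I_n) : R := Sigma_mx m S (fold_ord p) (fold_ord q).

(* A pair with beta = 0 is split into two blocks of size 1. *)
Let block (p : 'I_n) : nat :=
  if odd p && (beta_tilde S (rev_ord (fold_ord p)) != 0) then p.-1 else p.

Lemma block_bounds (p : 'I_n) : (block p <= p <= (block p).+1)%N.
Proof. by rewrite /block; case: ifP; lia. Qed.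

Lemma block_homo (p q : 'I_n) : (p <= q)%N -> (block p <= block q)%N.
Proof.
rewrite leq_eqVlt => /orP[/eqP/val_inj -> //|].
by have := block_bounds p; have := block_bounds q; lia.
Qed.

Lemma card_block (l : nat) : (#|[set p | block p == l]| <= 2)%N.
Proof.
rewrite cardE -(size_map val); apply: (uniq_leq_size (s2 := [:: l; l.+1])).
  by rewrite (map_inj_uniq val_inj) enum_uniq.
move=> _ /mapP[p + ->]; rewrite mem_enum !inE => /eqP p_l.
by have := block_bounds p; rewrite p_l /=; lia.
Qed.

(** Off-diagonal entries survive only between mirror indices, where they are plus or minus
    [beta_tilde]; such a pair has distinct labels only if this value is 0. *)
Lemma block_neq (p q : 'I_n) : (p < q)%N -> block p != block q ->
  T p q = 0 /\ T q p = 0.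
Proof.
move=> p_lt b_neq.
have fp_neq : (fold_ord q == fold_ord p) = false.
  by rewrite (inj_eq fold_ord_inj) -val_eqE /=; lia.
have [q_rev | q_nrev] := eqVneq (fold_ord q) (rev_ord (fold_ord p)); last first.
  split; rewrite /T mxE ?fp_neq ?(negPf q_nrev) //.
  by rewrite eq_sym fp_neq -(can_eq (@rev_ordK n)) rev_ordK eq_sym
    (negPf q_nrev).
have [q_odd q_eq] := fold_ord_rev p_lt q_rev.
have [fp_lt _] := fold_ord_pair q_odd q_eq.
have beta0 : beta_tilde S (fold_ord p) = 0.
  apply/eqP; apply: contraNT b_neq => beta_neq0.
  rewrite /block q_odd q_rev rev_ordK beta_neq0 /= q_eq /=.
  by have -> : odd p = false by lia.
have [_ _ T1 T2] := Sigma_pair S fp_lt.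
by rewrite /T q_rev T1 T2 beta0 oppr0.
Qed.

Lemma block_eq (p q : 'I_n) : (p < q)%N -> block p = block q ->
  [/\ T q q = T p p, T q p = - T p q & T p q != 0].
Proof.
move=> p_lt b_eq; have p_bd := block_bounds p.
(* As [block p <= p < q], equal labels force the label of q to be lowered, which happens only for
   odd q with nonzero [beta_tilde]. *)
have [q_odd beta_neq0] : odd q /\ beta_tilde S (rev_ord (fold_ord q)) != 0.
  by apply/andP; move: b_eq; rewrite /(block q); case: ifP => // _; lia.
have q_eq : q = p.+1 :> nat by have := block_bounds q; lia.
have [fp_lt q_rev] := fold_ord_pair q_odd q_eq.
have [T1 T2 T3 T4] := Sigma_pair S fp_lt.
rewrite q_rev rev_ordK in beta_neq0.
by rewrite /T q_rev T1 T2 T3 T4; split; [| |exact: beta_neq0].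
Qed.

Lemma Sigma_block_diag_schur :
  exists s : 'S_n, block_diag_schur
    ((perm_mx s)^T *m Sigma_mx m S *m perm_mx s).
Proof.
(* The inverse is the right choice: conjugating by [perm_mx s^-1] places the entry at ([s p], [s q])
   in position (p, q). *)
pose s := perm fold_ord_inj; exists (s^-1)%g.
have TE p q : ((perm_mx s^-1)^T *m Sigma_mx m S *m perm_mx s^-1) p q = T p q.
  by rewrite tr_perm_mx invgK -row_permE -col_permE mxE mxE !permE.
exists block; split=> [|l|p q b_neq|p q p_neq b_eq]; rewrite ?TE.
- exact: block_homo.
- exact: card_block.
- have [pq | qp | /val_inj pq] := ltngtP p q.
  + by case: (block_neq pq b_neq).
  + by rewrite eq_sym in b_neq; case: (block_neq qp b_neq).
  + by rewrite pq eqxx in b_neq.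
- have [pq | qp | /val_inj pq] := ltngtP p q.
  + exact: block_eq.
  + by have [-> -> ?] := block_eq qp (esym b_eq); rewrite opprK oppr_eq0.
  + by rewrite pq eqxx in p_neq.
Qed.

End Blocks.
End Schur.

Theorem theorem2p5 (R : realType) (n m : nat) (n_gt0 : (0 < n)%N)
    (n_eq : n = (2 * m)%N \/ n = (2 * m).+1)
    (S : 'M[R]_n) (S_skew : skew_circulant S) :
  [/\ orthogonal_mx (Utilde R n m),
      (Utilde R n m)^T *m S *m Utilde R n m = Sigma_mx m S &
      real_schur_form S (Sigma_mx m S)].
Proof.
have U_orth := Utilde_orthogonal R n_eq.
have U_Sigma := Utilde_Sigma n_eq S_skew.
split=> //; split; first by exists (Utilde R n m).
exact: Sigma_block_diag_schur.
Qed.
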